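(* Let $H$ be a Hilbert space, let $C\subset H$ be nonempty, closed, bounded and convex, and let $F:C\times C\to C$ be a weakly nonexpansive mapping that is demicompact at $0$. Then, for every $\lambda\in(0,1)$ and every $x_0\in C$, the double sequence $\{(x_n,x_n)\}_{n\ge 0}$ defined by $$x_{n+1}=\lambda x_n+(1-\lambda)F(x_n,x_n),\quad n\ge 0,$$ converges strongly (in norm) to a coupled fixed point of $F$.
   Context: A mapping $F:C\times C\to H$, with $C$ a subset of a normed linear space $H$, is called weakly nonexpansive if there are constants $a,b\ge 0$ with $a+b\le 1$ such that $\|F(x,y)-F(u,v)\|\le a\|x-u\|+b\|y-v\|$ for all $x,y,u,v\in C$. A pair $(x,y)\in C\times C$ is a coupled fixed point of $F$ if $F(x,y)=x$ and $F(y,x)=y$. For $C$ a subset of a Hilbert space $H$, a mapping $F:C\times C\to H$ is called demicompact at $0$ if, for any bounded sequence $\{x_n\}$ in $C$ such that $x_n-F(x_n,x_n)\to 0$ strongly as $n\to\infty$, there exist a subsequence $\{x_{n_j}\}$ and a point $x\in C$ such that $x_{n_j}\to x$ strongly as $j\to\infty$ and $x-F(x,x)=0$. *)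

(* Defs.v *)
From HB Require Import structures.
From mathcomp Require Import all_boot all_order all_algebra.
From mathcomp Require Import sesquilinear complex.
From mathcomp Require Import all_classical all_reals all_analysis.

Set Implicit Arguments.
Unset Strict Implicit.
Unset Printing Implicit Defensive.

Import Order.TTheory GRing.Theory Num.Theory.
Import numFieldNormedType.Exports.

Local Open Scope classical_set_scope.
Local Open Scope ring_scope.

(* [scalar_field R theta] says that [theta] is the conjugation of a scalar
   field of Hilbert spaces: the reals with the identity, or the complexes with
   complex conjugation. Norms are valued in K itself: for K = R[i], a scalar z
   satisfies 0 <= z only if it is a nonnegative real. *)
Variant scalar_field (R : realType) : forall K : numFieldType, (K -> K) -> Prop :=
  | RealScalars : @scalar_field R R idfun
  | ComplexScalars : @scalar_field R R[i] Num.conj.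

(* The space is given by a complete normed module H together with a positive
   definite hermitian form (linear in its first argument) that induces the
   norm of H. *)
Definition hilbert_product (K : numFieldType) (theta : K -> K)
    (H : normedModType K) (dot : {dot H for theta}) : Prop :=
  forall x : H, dot x x = `|x| ^+ 2.

(* A mapping F : C x C -> H is represented by a total function H -> H -> H
   whose values outside of C x C are never used. *)
Section coupled_mappings.
Variables (K : numFieldType) (H : normedModType K).
Variables (C : set H) (F : H -> H -> H).

Definition weakly_nonexpansive : Prop :=
  exists a b : K, [/\ 0 <= a, 0 <= b, a + b <= 1 &
    forall x y u v : H, C x -> C y -> C u -> C v ->
      `|F x y - F u v| <= a * `|x - u| + b * `|y - v|].

Definition coupled_fixed_point (p : H * H) : Prop :=
  [/\ C p.1, C p.2, F p.1 p.2 = p.1 & F p.2 p.1 = p.2].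

Definition demicompact_at0 : Prop :=
  forall x : nat -> H,
    (forall n, C (x n)) -> bounded_fun x ->
    x n - F (x n) (x n) @[n --> \oo] --> (0 : H) ->
    exists (phi : nat -> nat) (p : H),
      [/\ increasing_seq phi, C p, x (phi j) @[j --> \oo] --> p &
          p - F p p = 0].

End coupled_mappings.

(* Main.v *)
(* Put T u = F (u, u), a nonexpansive self-map of C. Iterating a contraction
   close to T yields p in C with |T p - p| as small as desired. In a Hilbert
   space, |x_(n+1) - p|^2 + c |x_n - T x_n|^2 <= |x_n - p|^2 up to a small error,
   where c = lambda (1 - lambda); since the residuals |x_n - T x_n| decrease,
   n c |x_n - T x_n|^2 stays bounded, so that x_n - T x_n --> 0 without knowing
   beforehand that T has a fixed point. Demicompactness then gives a subsequence
   converging to a fixed point q, and |x_n - q| is nonincreasing, so that the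
   whole sequence converges to q. *)
Require Import Defs.
From HB Require Import structures.
From mathcomp Require Import all_boot all_order all_algebra.
From mathcomp Require Import sesquilinear complex.
From mathcomp Require Import all_classical all_reals all_analysis.
From mathcomp Require Import ring.

Set Implicit Arguments.
Unset Strict Implicit.
Unset Printing Implicit Defensive.

Import Order.TTheory GRing.Theory Num.Theory.
Import numFieldNormedType.Exports.

Local Open Scope classical_set_scope.
Local Open Scope ring_scope.

(** * Scalars, the Hilbert norm identity, convex and bounded sets *)

Lemma scalar_field_archi (R : realType) (K : numFieldType) (theta : K -> K) :
  scalar_field R theta -> forall z : K, 0 <= z -> exists n : nat, z <= n%:R.
Proof.
case=> [|] z z_ge0.
  by exists (Num.bound z); exact: ltW (archi_boundP z_ge0).
(* A nonnegative element of [R[i]] is real, so bounding its real part suffices. *)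
exists (Num.bound (complex.Re z)).
move: z_ge0; rewrite -(rmorph_nat (real_complex R)) !lecE /=.
move=> /andP[/eqP -> Re_ge0].
by rewrite eqxx ltW// archi_boundP.
Qed.

Lemma scalar_field_conj_ge0 (R : realType) (K : numFieldType) (theta : K -> K) :
  scalar_field R theta -> forall z : K, 0 <= z -> theta z = z.
Proof. by case=> // z z_ge0; exact/conj_Creal/ger0_real. Qed.

(** Expand both sides: since [theta] fixes [t] and [1 - t], the cross terms [dot u v] and [dot v u]
    carry the coefficient [t * (1 - t)] on each side. *)
Lemma hilbert_norm_convex_comb (K : numFieldType) (theta : K -> K)
    (H : normedModType K) (dot : {dot H for theta}) (t : K) (u v : H) :
  hilbert_product dot -> theta t = t -> theta (1 - t) = 1 - t ->
  `|t *: u + (1 - t) *: v| ^+ 2 =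
    t * `|u| ^+ 2 + (1 - t) * `|v| ^+ 2 - t * (1 - t) * `|u - v| ^+ 2.
Proof.
move=> hdot tE t1E; rewrite -!hdot.
have dotZl a w z : dot (a *: w) z = a * dot w z by exact: linearZl_LR.
have dotZr a w z : dot w (a *: z) = theta a * dot w z by exact: linearZr_LR.
rewrite (linearBl dot) !(linearBr dot) (linearDl dot) !(linearDr dot) /=.
rewrite !(dotZl, dotZr) tE t1E.
by ring.
Qed.

Lemma convex_set_comb (K : numFieldType) (H : normedModType K) (C : set H)
    (t : K) (u v : H) :
  convex_set C -> 0 <= t -> t <= 1 -> C u -> C v ->
  C (t *: u + (1 - t) *: v).
Proof.
move=> C_convex t0 t1 Cu Cv.
have := C_convex u v (Itv01 t0 t1).
by rewrite !inE; apply.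
Qed.

Lemma bounded_set_diam (K : numFieldType) (H : normedModType K) (C : set H) :
  bounded_set C ->
  exists2 D : K, 0 < D & forall u v, C u -> C v -> `|u - v| <= D.
Proof.
move=> [M [M_real CM]].
have M1_gt0 : 0 < `|M| + 1 by rewrite ltr_wpDl.
have M1 : M < `|M| + 1.
  by rewrite (le_lt_trans (real_ler_norm M_real))// ltrDl.
exists ((`|M| + 1) *+ 2) => [|u v Cu Cv]; first by rewrite pmulrn_lgt0.
by rewrite (le_trans (ler_normB _ _))// mulr2n lerD// (CM _ M1).
Qed.

(** * Approximate fixed points of a nonexpansive self-map *)

Section nonexpansive.
Variables (K : numFieldType) (H : normedModType K) (C : set H) (T : H -> H).
Hypothesis K_archi : forall z : K, 0 <= z -> exists n : nat, z <= n%:R.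
Hypothesis C_convex : convex_set C.
Hypothesis T_C : forall u, C u -> C (T u).
Hypothesis T_ne : forall u v, C u -> C v -> `|T u - T v| <= `|u - v|.
Variable D : K.
Hypothesis D_gt0 : 0 < D.
Hypothesis C_diam : forall u v, C u -> C v -> `|u - v| <= D.

(* The iterates y_n of the contraction S u = t z + (1 - t) T u satisfy
   |y_(n+1) - y_n| <= (1 - t)^n D <= D / (1 + n t), and |S u - T u| <= t D. *)
Lemma nonexpansive_approx_fixed_point (eps : K) : 0 < eps -> C !=set0 ->
  exists2 p, C p & `|T p - p| <= eps.
Proof.
move=> eps_gt0 [z Cz].
have h_gt0 : 0 < eps / 2 by rewrite divr_gt0.
have [m mP] := K_archi (ltW (divr_gt0 D_gt0 h_gt0)).
have m1P : D / m.+1%:R <= eps / 2.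
  rewrite ler_pdivrMr ?ltr0n// mulrC -ler_pdivrMr//.
  by rewrite (le_trans mP)// ler_nat.
have [t tE] : exists t : K, t = m.+1%:R^-1 by eexists.
have t_gt0 : 0 < t by rewrite tE invr_gt0 ltr0n.
have t_le1 : t <= 1 by rewrite tE invf_le1 ?ltr0n// ler1n.
have onem_ge0 : 0 <= 1 - t by rewrite subr_ge0.
have [y [y0 yS]] : exists y : nat -> H,
    y 0%N = z /\ forall n, y n.+1 = t *: z + (1 - t) *: T (y n).
  by exists (fun n => iter n (fun u => t *: z + (1 - t) *: T u) z).
have Cy n : C (y n).
  elim: n => [|n IH]; first by rewrite y0.
  rewrite yS; apply: convex_set_comb => //; [exact: ltW | exact: T_C].
(* A division-free form of the decay; the induction rests on (1 - t)(1 + (n + 1) t) <= 1 + n t. *)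
have y_slow n : `|y n.+1 - y n| * (1 + t *+ n) <= D.
  elim: n => [|n IH]; first by rewrite mulr0n addr0 mulr1 C_diam.
  apply: le_trans IH.
  have -> : y n.+2 - y n.+1 = (1 - t) *: (T (y n.+1) - T (y n)).
    by rewrite !yS opprD addrACA subrr add0r -scalerBr.
  rewrite normrZ ger0_norm// [_ * `|_|]mulrC -mulrA.
  apply: ler_pM => //; first by rewrite mulr_ge0// addr_ge0// mulrn_wge0// ltW.
    exact: T_ne.
  rewrite -subr_ge0.
  have -> : 1 + t *+ n - (1 - t) * (1 + t *+ n.+1) = t * (t *+ n.+1).
    rewrite mulrSr -mulr_natr; set k : K := n%:R.
    by ring.
  by rewrite mulr_ge0 ?mulrn_wge0// ltW.
(* With t = 1 / (m + 1), this n makes 1 + n t = m + 1, so that [y_slow] gives the bound D / (m + 1)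
   <= eps / 2; the other half of eps pays for t D. *)
pose n := (m * m.+1)%N.
have tn : 1 + t *+ n = m.+1%:R.
  by rewrite -[t *+ _]mulr_natr tE natrM mulrCA mulVf ?pnatr_eq0// mulr1 addrC natr1.
exists (y n) => //.
rewrite -(subrKA (y n.+1)) [eps]splitr.
rewrite (le_trans (ler_normD _ _))// lerD//.
  have -> : T (y n) - y n.+1 = t *: (T (y n) - z).
    rewrite yS -{1}[T _]scale1r opprD addrCA -scalerBl.
    by rewrite subKr addrC -scalerBr.
  rewrite normrZ gtr0_norm// (le_trans _ m1P)// [leRHS]mulrC -tE.
  by rewrite ler_wpM2l ?(ltW t_gt0)// C_diam//; exact: T_C.
rewrite (le_trans _ m1P)// ler_pdivlMr ?ltr0n//.
by have := y_slow n; rewrite tn.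
Qed.

(** * The averaged iteration of T *)

Variables (lambda : K) (x : nat -> H).
Hypothesis lambda_gt0 : 0 < lambda.
Hypothesis lambda_lt1 : lambda < 1.
Hypothesis x0_C : C (x 0%N).
Hypothesis x_S : forall n, x n.+1 = lambda *: x n + (1 - lambda) *: T (x n).

Let onem_gt0 : 0 < 1 - lambda. Proof. by rewrite subr_gt0. Qed.

Lemma krasnoselskii_mem n : C (x n).
Proof.
elim: n => // n IH; rewrite x_S.
by apply: convex_set_comb => //; rewrite ?ltW//; exact: T_C.
Qed.

(** The new residual is lambda times the old one plus T x_n - T x_(n+1), and the latter has norm at
    most |x_n - x_(n+1)|, which is 1 - lambda times the old residual norm. *)
Lemma krasnoselskii_residual_decr n :
  `|x n.+1 - T (x n.+1)| <= `|x n - T (x n)|.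
Proof.
have Cx := krasnoselskii_mem.
have -> : x n.+1 - T (x n.+1) =
    lambda *: (x n - T (x n)) + (T (x n) - T (x n.+1)).
  rewrite scalerBr addrA; congr (_ - _).
  by rewrite x_S scalerBl scale1r -addrA [- _ + _]addrC.
rewrite (le_trans (ler_normD _ _))//.
rewrite (le_trans (lerD (lexx _) (T_ne (Cx n) (Cx n.+1))))//.
have -> : x n - x n.+1 = (1 - lambda) *: (x n - T (x n)).
  by rewrite x_S scalerBr [in RHS]scalerBl scale1r opprD addrA.
by rewrite !normrZ !gtr0_norm// -mulrDl addrC subrK mul1r.
Qed.

Lemma krasnoselskii_fejer p n : C p -> T p = p ->
  `|x n.+1 - p| <= `|x n - p|.
Proof.
move=> Cp Tp.
have -> : x n.+1 - p = lambda *: (x n - p) + (1 - lambda) *: (T (x n) - T p).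
  by rewrite x_S Tp !scalerBr addrACA -opprD -scalerDl [lambda + _]addrC subrK scale1r.
rewrite (le_trans (ler_normD _ _))// !normrZ !gtr0_norm//.
rewrite -[leRHS]mul1r -[X in _ <= X * _](subrK lambda) [X in _ <= X * _]addrC.
by rewrite [leRHS]mulrDl lerD2l ler_wpM2l ?(ltW onem_gt0)//; apply: T_ne => //; exact: krasnoselskii_mem.
Qed.

Hypothesis norm_comb : forall u v : H,
  `|lambda *: u + (1 - lambda) *: v| ^+ 2 =
    lambda * `|u| ^+ 2 + (1 - lambda) * `|v| ^+ 2 -
    lambda * (1 - lambda) * `|u - v| ^+ 2.

(** Apply [norm_comb] to x_n - p and T x_n - p, whose difference is the residual. Replacing |T x_n -
    p|^2 by |x_n - p|^2 costs at most delta (|T x_n - p| + |x_n - p|) <= 2 D delta. *)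
Lemma krasnoselskii_approx_fejer p delta n : C p -> `|T p - p| <= delta ->
  `|x n.+1 - p| ^+ 2 + lambda * (1 - lambda) * `|x n - T (x n)| ^+ 2 <=
  `|x n - p| ^+ 2 + delta * (D *+ 2).
Proof.
move=> Cp Tp; have Cx := krasnoselskii_mem n.
have delta_ge0 : 0 <= delta by exact: le_trans Tp.
have -> : x n.+1 - p = lambda *: (x n - p) + (1 - lambda) *: (T (x n) - p).
  by rewrite x_S !scalerBr addrACA -opprD -scalerDl [lambda + _]addrC subrK scale1r.
rewrite norm_comb [_ - p - (_ - p)](_ : _ = x n - T (x n)); last first.
  by rewrite opprB addrA subrK.
rewrite subrK.
have Tsq : `|T (x n) - p| ^+ 2 <= `|x n - p| ^+ 2 + delta * (D *+ 2).
  have Txp : `|T (x n) - p| - `|x n - p| <= delta.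
    rewrite lerBlDl (le_trans (ler_distD (T p) _ _))// lerD//.
    exact: T_ne.
  rewrite -lerBlDl subr_sqr.
  rewrite (@le_trans _ _ (delta * (`|T (x n) - p| + `|x n - p|)))//.
    by rewrite ler_wpM2r// addr_ge0.
  by rewrite ler_wpM2l// mulr2n lerD// C_diam//; exact: T_C.
rewrite (le_trans (lerD (lexx _) (ler_wpM2l (ltW onem_gt0) Tsq)))//.
rewrite -subr_ge0; set a := (X in 0 <= X).
have -> : a = lambda * (delta * (D *+ 2)) by rewrite /a; ring.
by rewrite mulr_ge0 ?mulr_ge0 ?mulrn_wge0 ?(ltW lambda_gt0) ?(ltW D_gt0).
Qed.

(* Summing the Fejer-type inequalities at an approximate fixed point of
   precision 1 / (n + 1) bounds the sum of the n first squared residuals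
   uniformly in n. *)
Lemma krasnoselskii_residual_bound n :
  lambda * (1 - lambda) * `|x n - T (x n)| ^+ 2 *+ n <= D ^+ 2 + D *+ 2.
Proof.
set c := lambda * (1 - lambda).
have c_ge0 : 0 <= c by rewrite mulr_ge0// ltW.
have n1_gt0 : 0 < n.+1%:R^-1 :> K by rewrite invr_gt0 ltr0n.
have [p Cp Tp] := nonexpansive_approx_fixed_point n1_gt0 (ex_intro _ _ x0_C).
set e := n.+1%:R^-1 * (D *+ 2).
have e_ge0 : 0 <= e by rewrite mulr_ge0 ?mulrn_wge0 ?ltW.
(* As residuals decrease, k copies of the current squared residual stand in for the sum of the
   earlier ones. *)
have step k : `|x k - p| ^+ 2 + c * `|x k - T (x k)| ^+ 2 *+ k <=
    D ^+ 2 + e *+ k.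
  elim: k => [|k IH].
    by rewrite !mulr0n !addr0 lerXn2r ?nnegrE ?(ltW D_gt0)// C_diam.
  rewrite [e *+ _]mulrSr addrA.
  apply: le_trans (lerD IH (lexx e)).
  rewrite addrAC (le_trans _ (lerD (krasnoselskii_approx_fejer k Cp Tp) (lexx _)))//.
  rewrite -addrA lerD2l -mulrS lerMn2r ler_wpM2l ?orbT//.
  by rewrite lerXn2r ?nnegrE// krasnoselskii_residual_decr.
apply: (@le_trans _ _ (D ^+ 2 + e *+ n)).
  by apply: le_trans (step n); rewrite lerDr exprn_ge0.
(* The accumulated error is 2 D n / (n + 1) <= 2 D. *)
rewrite lerD2l -mulrnAl ler_piMl ?mulrn_wge0 ?(ltW D_gt0)//.
by rewrite -mulr_natr mulrC ler_pdivrMr ?ltr0n// mul1r ler_nat.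
Qed.

Lemma krasnoselskii_asymptotically_regular :
  x n - T (x n) @[n --> \oo] --> (0 : H).
Proof.
apply/cvgr0Pnorm_le => eps eps_gt0.
set c := lambda * (1 - lambda).
have c_gt0 : 0 < c by rewrite mulr_gt0.
have ce_gt0 : 0 < c * eps ^+ 2 by rewrite mulr_gt0// exprn_gt0.
have B_ge0 : 0 <= D ^+ 2 + D *+ 2.
  by rewrite addr_ge0 ?exprn_ge0 ?mulrn_wge0 ?ltW.
have [N NP] := K_archi (divr_ge0 B_ge0 (ltW ce_gt0)).
near=> n.
have n_gt0 : (0 < n)%N by near: n; exact: nbhs_infty_gt.
rewrite -(@ler_pXn2r _ 2)// ?nnegrE ?(ltW eps_gt0)//.
rewrite -(ler_pM2l c_gt0).
(* The left side is bounded independently of n, while the right side exceeds that bound once n >=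
   N. *)
suff : c * `|x n - T (x n)| ^+ 2 *+ n <= c * eps ^+ 2 *+ n.
  by rewrite lerMn2r eqn0Ngt n_gt0.
rewrite (le_trans (krasnoselskii_residual_bound n))//.
rewrite -mulr_natr [leRHS]mulrC -ler_pdivrMr// (le_trans NP)// ler_nat.
by near: n; exact: nbhs_infty_ge.
Unshelve. all: by end_near. Qed.

Lemma krasnoselskii_subseq_cvg (phi : nat -> nat) p : C p -> T p = p ->
  x (phi j) @[j --> \oo] --> p -> x n @[n --> \oo] --> p.
Proof.
move=> Cp Tp /cvgrPdist_le xphi; apply/cvgrPdist_le => eps eps_gt0.
(* A single term within eps of p is enough: Fejer monotonicity keeps all later terms there. *)
have [j _ /(_ j (leqnn j)) xj] := xphi _ eps_gt0.
exists (phi j) => // n /= /subnK <-; rewrite distrC.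
elim: (n - phi j)%N => [|k IH]; first by rewrite add0n distrC.
exact: le_trans (krasnoselskii_fejer _ Cp Tp) IH.
Qed.

End nonexpansive.

Theorem theorem4 (R : realType) (K : numFieldType) (theta : K -> K)
  (hK : scalar_field R theta)
  (H : completeNormedModType K) (dot : {dot H for theta})
  (hdot : hilbert_product dot)
  (C : set H) (C_neq0 : C !=set0) (C_closed : closed C)
  (C_bounded : bounded_set C) (C_convex : convex_set C)
  (F : H -> H -> H) (F_C : forall x y : H, C x -> C y -> C (F x y))
  (F_wne : weakly_nonexpansive C F) (F_demi : demicompact_at0 C F)
  (lambda : K) (lambda_gt0 : 0 < lambda) (lambda_lt1 : lambda < 1)
  (x0 : H) (x0_C : C x0) (x : nat -> H) (x_0 : x 0%N = x0)
  (x_S : forall n : nat,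
    x n.+1 = lambda *: x n + (1 - lambda) *: F (x n) (x n)) :
  exists p : H * H,
    coupled_fixed_point C F p /\ (x n, x n) @[n --> \oo] --> p.
Proof.
have K_archi := scalar_field_archi hK.
have norm_comb (u v : H) : `|lambda *: u + (1 - lambda) *: v| ^+ 2 =
    lambda * `|u| ^+ 2 + (1 - lambda) * `|v| ^+ 2 -
    lambda * (1 - lambda) * `|u - v| ^+ 2.
  apply: (hilbert_norm_convex_comb u v hdot);
    by apply: (scalar_field_conj_ge0 hK); rewrite ?subr_ge0 ltW.
have [D D_gt0 C_diam] := bounded_set_diam C_bounded.
pose T u := F u u.
have T_C u : C u -> C (T u) by move=> Cu; exact: F_C.
have T_ne u v : C u -> C v -> `|T u - T v| <= `|u - v|.
  case: F_wne => a [b [a_ge0 b_ge0 ab_le1 F_lip]] Cu Cv.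
  by apply: le_trans (F_lip _ _ _ _ Cu Cu Cv Cv) _; rewrite -mulrDl ler_piMl.
rewrite -x_0 in x0_C.
have Cx n : C (x n) by exact: (krasnoselskii_mem C_convex T_C lambda_gt0 lambda_lt1 x0_C x_S).
have x_bounded : bounded_fun x.
  case: C_bounded => M [M_real CM]; exists M; split=> // N MN n _ /=.
  exact: (CM _ MN).
have x_reg : x n - T (x n) @[n --> \oo] --> (0 : H).
  exact: (krasnoselskii_asymptotically_regular K_archi C_convex T_C T_ne D_gt0
    C_diam lambda_gt0 lambda_lt1 x0_C x_S norm_comb).
have [phi [p [_ Cp x_phi /subr0_eq/esym Tp]]] := F_demi _ Cx x_bounded x_reg.
have x_cvg : x n @[n --> \oo] --> p.
  exact: (krasnoselskii_subseq_cvg C_convex T_C T_ne lambda_gt0 lambda_lt1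
    x0_C x_S Cp Tp x_phi).
(* On the diagonal both coupled equations reduce to F p p = p. *)
by exists (p, p); split; [split | exact: cvg_pair].
Qed.
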